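(* Let $G_1$ and $G_2$ be finite simple graphs, where $G_i$ has $n_i$ vertices, $m_i$ edges, minimum degree $\delta_{G_i}$ and maximum degree $\Delta_{G_i}$ ($i=1,2$). Then $\alpha_1 \leq ESO(G_1\circ G_2)\leq \alpha_2$, where $$\alpha_1=2\sqrt{2}\,m_1(\delta_{G_1}+n_2)^2+2\sqrt{2}\,n_1m_2(\delta_{G_2}+1)^2+n_1n_2(\delta_{G_1}+n_2+\delta_{G_2}+1)\{(\delta_{G_1}+n_2)^2+(\delta_{G_2}+1)^2\}^{\frac{1}{2}},$$ $$\alpha_2=2\sqrt{2}\,m_1(\Delta_{G_1}+n_2)^2+2\sqrt{2}\,n_1m_2(\Delta_{G_2}+1)^2+n_1n_2(\Delta_{G_1}+n_2+\Delta_{G_2}+1)\{(\Delta_{G_1}+n_2)^2+(\Delta_{G_2}+1)^2\}^{\frac{1}{2}}.$$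
   Context: For a graph $G$ and vertex $u$, $d(u)$ denotes the degree of $u$ in $G$. The elliptic Sombor index of a graph $G$ is $ESO(G)=\sum_{uv\in E(G)}(d(u)+d(v))\sqrt{d(u)^2+d(v)^2}$. The corona product $G_1\circ G_2$, where $G_1$ has vertices $u_1,\dots,u_{n_1}$, is the graph obtained by taking $G_1$ together with $n_1$ vertex-disjoint copies of $G_2$ and joining the vertex $u_i$ of $G_1$ by an edge to every vertex of the $i$-th copy of $G_2$, for $i=1,\dots,n_1$. *)

(* Defs.v *)
From HB Require Import structures.
From mathcomp Require Import all_boot all_order all_algebra.

Set Implicit Arguments.
Unset Strict Implicit.
Unset Printing Implicit Defensive.

Import Order.TTheory GRing.Theory Num.Theory.

Record sgraph := SGraph {
  vertex :> finType;
  adj : rel vertex;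
  adj_sym : symmetric adj;
  adj_irr : irreflexive adj
}.

Section Basics.
Variable G : sgraph.

Definition edges : {set {set G}} :=
  [set e | [exists u, exists v, adj u v && (e == [set u; v])]].

Definition deg (u : G) : nat := #|[set v | adj u v]|.

(* Every degree is < #|G|, so the neutral element #|G| never affects the
   minimum of a nonempty graph; the empty graph gets mindeg = maxdeg = 0. *)
Definition mindeg : nat := \big[minn/#|G|]_(u : G) deg u.

Definition maxdeg : nat := \max_(u : G) deg u.

End Basics.

Section Corona.
Variables G1 G2 : sgraph.

(* inl u is the vertex u of G1; inr (u, x) is the vertex x in the copy of G2
   attached to u. *)
Definition corona_vertex : finType := (G1 + G1 * G2)%type.

Definition corona_adj : rel corona_vertex := fun a b =>
  match a, b with
  | inl u, inl v => adj u v
  | inl u, inr (v, _) => u == v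
  | inr (u, _), inl v => u == v
  | inr (u, x), inr (v, y) => (u == v) && adj x y
  end.

Lemma corona_adj_sym : symmetric corona_adj.
Proof.
move=> [u|[u x]] [v|[v y]] /=; first exact: adj_sym.
- exact: eq_sym.
- exact: eq_sym.
- by rewrite eq_sym adj_sym.
Qed.

Lemma corona_adj_irr : irreflexive corona_adj.
Proof. by move=> [u|[u x]] /=; rewrite adj_irr ?andbF. Qed.

Definition corona : sgraph := SGraph corona_adj_sym corona_adj_irr.

End Corona.

Local Open Scope ring_scope.

(* An edge is a two-element set e = {u, v}, so the sums over e are
   d(u) + d(v) and d(u)^2 + d(v)^2; see ESO_weightE. *)
Definition ESO_weight (R : rcfType) (G : sgraph) (e : {set G}) : R :=
  (\sum_(u in e) (deg u)%:R) * Num.sqrt (\sum_(u in e) (deg u)%:R ^+ 2).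

Definition ESO (R : rcfType) (G : sgraph) : R :=
  \sum_(e in edges G) ESO_weight R e.

Lemma ESO_weightE (R : rcfType) (G : sgraph) (u v : G) : adj u v ->
  ESO_weight R [set u; v] =
  ((deg u)%:R + (deg v)%:R) * Num.sqrt ((deg u)%:R ^+ 2 + (deg v)%:R ^+ 2).
Proof.
move=> uv; have neq : u \notin [set v].
  by rewrite inE; apply: contraTneq uv => ->; rewrite adj_irr.
by rewrite /ESO_weight !big_setU1 // !big_set1.
Qed.

(* Main.v *)
(* In the corona, a vertex u of G1 has degree d(u) + n2 and a vertex x of a copy
   of G2 has degree d(x) + 1.  Summing over ordered adjacent pairs, twice the
   index becomes a sum over G1, over G1 x G2 and over n1 copies of G2 that is
   monotone in these degrees, so replacing them by their extreme values gives
   both bounds. *)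
Require Import Defs.
From mathcomp Require Import all_boot all_order all_algebra.
From mathcomp Require Import ring.
Import Order.TTheory GRing.Theory Num.Theory.
Local Open Scope ring_scope.

Lemma mindeg_le (G : sgraph) (u : G) : (mindeg G <= deg u)%N.
Proof. by rewrite /mindeg -minEnat -leEnat; apply: bigmin_le. Qed.

Lemma deg_le_maxdeg (G : sgraph) (u : G) : (deg u <= maxdeg G)%N.
Proof. exact: leq_bigmax. Qed.

(** Irreflexivity excludes [x = y], so an edge arises from exactly its two orderings. *)
Lemma set2_adj_eq (G : sgraph) (u v x y : G) : adj u v -> adj x y ->
  ([set x; y] == [set u; v]) = ((x, y) \in [set (u, v); (v, u)]).
Proof.
move=> uv xy; rewrite !inE !xpair_eqE; apply/eqP/idP; last first.
  by case/orP=> /andP[/eqP-> /eqP->] //; rewrite setUC.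
move=> exy; have /set2P[] : x \in [set u; v] by rewrite -exy set21.
  move=> xu; rewrite xu eqxx /=; have /set2P[yu|->] : y \in [set u; v].
  - by rewrite -exy set22.
  - by rewrite xu yu adj_irr in xy.
  - by rewrite eqxx.
move=> xv; rewrite xv eqxx /=; have /set2P[->|yv] : y \in [set u; v].
- by rewrite -exy set22.
- by rewrite eqxx orbT.
- by rewrite xv yv adj_irr in xy.
Qed.

(** Weighted handshake: grouping ordered adjacent pairs by their edge gives fibres
    [{(u, v), (v, u)}], of size two because there are no loops. *)
Lemma sum_adj_edges (V : nmodType) (G : sgraph) (F : {set G} -> V) :
  \sum_u \sum_(v | adj u v) F [set u; v] = (\sum_(e in edges G) F e) *+ 2.
Proof.
rewrite pair_big_dep /=.
rewrite (partition_big (fun p : G * G => [set p.1; p.2]) (mem (edges G))) /=.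
  rewrite -sumrMnl; apply: eq_bigr => e; rewrite inE.
  case/existsP=> u /existsP[v /andP[uv /eqP->]].
  have uDv : (u, v) != (v, u).
    by apply: contraTneq uv => -[-> _]; rewrite adj_irr.
  rewrite (eq_bigr (fun=> F [set u; v])) => [|p /andP[_ /eqP-> //]].
  rewrite (eq_bigl (mem [set (u, v); (v, u)])) => [|[x y] /=].
    by rewrite sumr_const cards2 uDv.
  apply/andP/idP => [[xy]|xy]; first by rewrite (set2_adj_eq _ _ _ _ _ uv).
  suff axy : adj x y by rewrite (set2_adj_eq _ _ _ _ _ uv).
  by move: xy => /set2P[] [-> ->] //; rewrite adj_sym.
move=> [u v] /= uv; rewrite inE; apply/existsP; exists u; apply/existsP.
by exists v; rewrite uv eqxx.
Qed.

Lemma sum_adj_const (V : nmodType) (G : sgraph) (c : V) :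
  \sum_(u : G) \sum_(v : G | adj u v) c = c *+ #|edges G| *+ 2.
Proof. by rewrite (@sum_adj_edges _ G (fun=> c)) sumr_const. Qed.

Section CoronaSums.
Variables (R : Type) (idx : R) (op : Monoid.com_law idx) (G1 G2 : sgraph).
Implicit Type F : corona G1 G2 -> R.

(** A general commutative monoid lets one decomposition of the neighbourhood serve both for counting
    degrees in [nat] and for summing weights in a field. *)
Lemma big_corona_inl (u : G1) F :
  \big[op/idx]_(b | adj (inl u : corona G1 G2) b) F b =
  op (\big[op/idx]_(v | adj u v) F (inl v)) (\big[op/idx]_x F (inr (u, x))).
Proof.
rewrite big_sumType /=; congr (op _ _).
(* The fixed [u] becomes an index [v] restricted to [v == u], so that both sides range over pairs in
   [G1 * G2]. *)
rewrite -[RHS](big_pred1_eq op u (fun v => \big[op/idx]_x F (inr (v, x)))).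
rewrite pair_big /=; apply: eq_big => -[v x] //.
by rewrite /= andbT eq_sym.
Qed.

Lemma big_corona_inr (u : G1) (x : G2) F :
  \big[op/idx]_(b | adj (inr (u, x) : corona G1 G2) b) F b =
  op (F (inl u)) (\big[op/idx]_(y | adj x y) F (inr (u, y))).
Proof.
rewrite big_sumType /=; congr (op _ _).
  by apply: big_pred1 => v /=; rewrite eq_sym.
rewrite -[RHS](big_pred1_eq op u
  (fun v => \big[op/idx]_(y | adj x y) F (inr (v, y)))).
rewrite pair_big /=; apply: eq_big => -[v y] //.
by rewrite /= eq_sym.
Qed.

End CoronaSums.

Lemma deg_corona_inl (G1 G2 : sgraph) (u : G1) :
  @deg (corona G1 G2) (inl u) = (deg u + #|G2|)%N.
Proof. by rewrite /deg -!sum1dep_card big_corona_inl /= (sum1_card G2). Qed.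

Lemma deg_corona_inr (G1 G2 : sgraph) (u : G1) (x : G2) :
  @deg (corona G1 G2) (inr (u, x)) = (deg x + 1)%N.
Proof. by rewrite /deg -!sum1dep_card big_corona_inr /= addnC. Qed.

Section EllipticSombor.
Variable R : rcfType.
Implicit Types (G : sgraph) (a b c d : R).

Definition sombor a b : R := (a + b) * Num.sqrt (a ^+ 2 + b ^+ 2).

Lemma somborC a b : sombor a b = sombor b a.
Proof. by rewrite /sombor addrC [a ^+ 2 + _]addrC. Qed.

(** Source of the factor [2 * Num.sqrt 2] for edges whose two ends get the same degree bound. *)
Lemma sombor_diag a : 0 <= a -> sombor a a = 2 * Num.sqrt 2 * a ^+ 2.
Proof.
move=> a0; rewrite /sombor -!mulr2n -[a ^+ 2 *+ 2]mulr_natl.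
by rewrite sqrtrM // sqrtr_sqr ger0_norm // -[a *+ 2]mulr_natl mulrACA -expr2.
Qed.

Lemma ler_sombor a b c d :
  0 <= a -> 0 <= b -> a <= c -> b <= d -> sombor a b <= sombor c d.
Proof.
move=> a0 b0 ac bd; apply: ler_pM; rewrite ?sqrtr_ge0 ?addr_ge0 ?lerD //.
by rewrite ler_wsqrtr // lerD // lerXn2r // nnegrE (le_trans _ ac, le_trans _ bd).
Qed.

Lemma ESO_double G :
  ESO R G *+ 2 = \sum_u \sum_(v : G | adj u v) sombor (deg u)%:R (deg v)%:R.
Proof.
rewrite -sum_adj_edges; apply: eq_bigr => u _; apply: eq_bigr => v uv.
exact: ESO_weightE.
Qed.

Variables G1 G2 : sgraph.

(** Twice the index of the corona with its degrees replaced by free functions [f] and [g]; the true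
    degrees and the constant bounds are both instances. Joining edges count twice, once per
    orientation. *)
Definition corona_sum (f : G1 -> R) (g : G2 -> R) : R :=
  \sum_u \sum_(v | adj u v) sombor (f u) (f v)
  + (\sum_u \sum_x sombor (f u) (g x)) *+ 2
  + (\sum_x \sum_(y | adj x y) sombor (g x) (g y)) *+ #|G1|.

Lemma ESO_corona : ESO R (corona G1 G2) *+ 2 =
  corona_sum (fun u => (deg u)%:R + #|G2|%:R) (fun x => (deg x)%:R + 1).
Proof.
rewrite ESO_double big_sumType /=.
under eq_bigr do rewrite big_corona_inl.
rewrite big_split /= /corona_sum mulr2n -!addrA; congr (_ + _).
  apply: eq_bigr => u _; apply: eq_bigr => v _.
  by rewrite !deg_corona_inl !natrD.
congr (_ + _).
  apply: eq_bigr => u _; apply: eq_bigr => x _.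
  by rewrite deg_corona_inl deg_corona_inr !natrD.
(* Only the vertices [(u, x)] of the copies remain: the edge back to [u] gives the second cross sum,
   and the edges inside the copy give the [G2] sum, repeated for each [u]. *)
rewrite -(sumr_const G1) -big_split /=.
under [in RHS]eq_bigr do rewrite -big_split /=.
rewrite pair_bigA; apply: eq_bigr => -[u x] _ /=.
rewrite big_corona_inr deg_corona_inl deg_corona_inr somborC !natrD.
by congr (_ + _); apply: eq_bigr => y _; rewrite deg_corona_inr natrD.
Qed.

Lemma ler_corona_sum (f f' : G1 -> R) (g g' : G2 -> R) :
  (forall u, 0 <= f u <= f' u) -> (forall x, 0 <= g x <= g' x) ->
  corona_sum f g <= corona_sum f' g'.
Proof.
move=> ff' gg'.
have [f0 lef] : (forall u, 0 <= f u) /\ (forall u, f u <= f' u).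
  by split=> u; have /andP[] := ff' u.
have [g0 leg] : (forall x, 0 <= g x) /\ (forall x, g x <= g' x).
  by split=> x; have /andP[] := gg' x.
(* [lerMn2r] offers a zero multiplicity as an alternative; the termwise inequality is proved
   instead, whatever the size of [G1]. *)
by rewrite !lerD ?lerMn2r //; do ?[apply/orP; right];
  do 2![apply: ler_sum => ? _]; apply: ler_sombor.
Qed.

Lemma corona_sum_const (a b : R) : 0 <= a -> 0 <= b ->
  corona_sum (fun=> a) (fun=> b) =
  (2 * Num.sqrt 2 * #|edges G1|%:R * a ^+ 2
   + 2 * Num.sqrt 2 * #|G1|%:R * #|edges G2|%:R * b ^+ 2
   + #|G1|%:R * #|G2|%:R * (a + b) * Num.sqrt (a ^+ 2 + b ^+ 2)) *+ 2.
Proof.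
move=> a0 b0; rewrite /corona_sum !sum_adj_const.
under [X in _ + X *+ 2 + _]eq_bigr do rewrite sumr_const.
rewrite sumr_const !sombor_diag // /sombor.
ring.
Qed.

End EllipticSombor.

Theorem theorem3 (R : rcfType) (G1 G2 : sgraph) :
  let n1 : R := #|G1|%:R in
  let n2 : R := #|G2|%:R in
  let m1 : R := #|edges G1|%:R in
  let m2 : R := #|edges G2|%:R in
  let d1 : R := (mindeg G1)%:R in
  let d2 : R := (mindeg G2)%:R in
  let D1 : R := (maxdeg G1)%:R in
  let D2 : R := (maxdeg G2)%:R in
  let alpha1 : R :=
    2 * Num.sqrt 2 * m1 * (d1 + n2) ^+ 2
    + 2 * Num.sqrt 2 * n1 * m2 * (d2 + 1) ^+ 2
    + n1 * n2 * (d1 + n2 + d2 + 1)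
      * Num.sqrt ((d1 + n2) ^+ 2 + (d2 + 1) ^+ 2) in
  let alpha2 : R :=
    2 * Num.sqrt 2 * m1 * (D1 + n2) ^+ 2
    + 2 * Num.sqrt 2 * n1 * m2 * (D2 + 1) ^+ 2
    + n1 * n2 * (D1 + n2 + D2 + 1)
      * Num.sqrt ((D1 + n2) ^+ 2 + (D2 + 1) ^+ 2) in
  alpha1 <= ESO R (corona G1 G2) /\ ESO R (corona G1 G2) <= alpha2.
Proof.
move=> n1 n2 m1 m2 d1 d2 D1 D2 alpha1 alpha2.
have [n2_ge0 d1_ge0 d2_ge0] : [/\ 0 <= n2, 0 <= d1 & 0 <= d2] by [].
have [D1_ge0 D2_ge0] : 0 <= D1 /\ 0 <= D2 by [].
(* Both inequalities are doubled to match the sum over ordered pairs. *)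
rewrite -(@ler_pMn2r _ 2) // -(@ler_pMn2r _ 2 _ (ESO _ _)) // ESO_corona.
(* Regrouping [d1 + n2 + d2 + 1] as [(d1 + n2) + (d2 + 1)], and likewise for the maxima, exhibits
   each doubled bound as [corona_sum] at constants. *)
rewrite /alpha1 /alpha2 -!(addrA (_ + n2)) -!corona_sum_const ?addr_ge0 //.
split; apply: ler_corona_sum => z; rewrite addr_ge0 // lerD2r ler_nat.
- exact: mindeg_le.
- exact: mindeg_le.
- exact: deg_le_maxdeg.
- exact: deg_le_maxdeg.
Qed.
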